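(* For $\gamma\in\mathbb{R}_+$ let $\widehat\pi^\dagger_\gamma$ be the candidate estimator and let $\widehat Q^\dagger_\gamma=\sum_{j=1}^m\widehat\pi^\dagger_{j,\gamma}\,\varrho(\theta_j)$ be the corresponding mixing distribution. Let $\widehat\pi$ be a maximum likelihood estimator, i.e. a maximizer of $l(\pi)$ over the unit simplex of $\mathbb{R}^m$, and let $\widehat Q=\sum_{j=1}^m\widehat\pi_j\,\varrho(\theta_j)$. Then, as $\gamma\to\infty$, $\mathbf{g}_{\widehat Q^\dagger_\gamma}\to\mathbf{g}_{\widehat Q}$. Consequently, $\widehat\pi^\dagger_\gamma$ converges to the MLE $\widehat\pi$ as $\gamma\to\infty$ whenever the latter is unique.
   Context: $\mathbb{R}_+=(0,\infty)$. $y_1,\dots,y_d$ are the distinct observed data vectors, $y_i$ occurring $n_i\ge 1$ times in the sample, and $n=\sum_{i=1}^d n_i$. $\{f_\theta:\theta\in\Omega\}$ is a family of probability densities and $\Theta_m=\{\theta_1,\dots,\theta_m\}\subset\Omega$ is a fixed finite support set. It is assumed that for each $j$ there is an $i$ with $f_{\theta_j}(y_i)>0$, and for each $i$ there is a $j$ with $f_{\theta_j}(y_i)>0$. $\varrho(\theta)$ denotes the point mass at $\theta$. For $Q=\sum_{j=1}^m\pi_j\varrho(\theta_j)$ with $\pi$ in the unit simplex of $\mathbb{R}^m$, $g_Q(y_i)=\sum_{j=1}^m\pi_j f_{\theta_j}(y_i)$, $\mathbf{g}_Q=(g_Q(y_1),\dots,g_Q(y_d))^T\in\mathbb{R}^d$,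 and $l(\pi)=\sum_{i=1}^d n_i\log g_Q(y_i)$. For $w\in\mathbb{R}_+^d$ the constraint function is $p_{\theta_j}(w)=\sum_{i=1}^d w_i f_{\theta_j}(y_i)>0$. For $\gamma\in\mathbb{R}_+$, the Penalized Dual solution $\widehat w_\gamma$ is the maximizer over $w\in\mathbb{R}_+^d$ of $$\mathcal{H}_\gamma(w)=\sum_{i=1}^d \frac{n_i}{n}\log w_i-\frac1\gamma\sum_{j=1}^m\{p_{\theta_j}(w)\}^\gamma .$$ The candidate estimator is $\widehat\pi^\dagger_\gamma=(\widehat\pi^\dagger_{1,\gamma},\dots,\widehat\pi^\dagger_{m,\gamma})^T$ with $$\widehat\pi^\dagger_{j,\gamma}=\frac{\{p_{\theta_j}(\widehat w_\gamma)\}^{\gamma-1}}{\sum_{k=1}^m\{p_{\theta_k}(\widehat w_\gamma)\}^{\gamma-1}},\qquad j=1,\dots,m.$$ *)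

(* Defs.v *)
From HB Require Import structures.
From mathcomp Require Export all_boot all_order all_algebra.
From mathcomp Require Export all_classical all_reals all_analysis.

Set Implicit Arguments.
Unset Strict Implicit.
Unset Printing Implicit Defensive.

Import Order.TTheory GRing.Theory Num.Theory.
Import numFieldNormedType.Exports.

Local Open Scope classical_set_scope.
Local Open Scope ring_scope.

Definition density_family (R : realType) (disp : measure_display)
    (Y : measurableType disp) (mu : {measure set Y -> \bar R})
    (Omega : Type) (f : Omega -> Y -> R) : Prop :=
  forall t : Omega,
    [/\ measurable_fun [set: Y] (f t),
        forall x : Y, 0 <= f t x
      & (\int[mu]_x (f t x)%:E = 1)%E].

Definition in_simplex (R : realType) (m : nat) (pi : 'cV[R]_m) : Prop :=
  (forall j, 0 <= pi j 0) /\ \sum_(j < m) pi j 0 = 1.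

Definition pos_orthant (R : realType) (d : nat) (w : 'cV[R]_d) : Prop :=
  forall i, 0 < w i 0.

(* The vector g_Q of the mixing distribution Q = \sum_j pi_j delta_(theta_j);
   the support theta being fixed, Q is given by its vector of weights pi. *)
Definition mixture_vec (R : realType) (Omega Y : Type) (f : Omega -> Y -> R)
    (m d : nat) (theta : 'I_m -> Omega) (y : 'I_d -> Y) (pi : 'cV[R]_m) :
    'cV[R]_d :=
  \col_(i < d) \sum_(j < m) pi j 0 * f (theta j) (y i).

(* Extended-real valued: some weights in the simplex may give g_Q(y_i) = 0, and
   then l(pi) = -oo since lne 0 = -oo, whereas the real logarithm has ln 0 = 0. *)
Definition loglik (R : realType) (Omega Y : Type) (f : Omega -> Y -> R)
    (m d : nat) (theta : 'I_m -> Omega) (y : 'I_d -> Y) (cnt : 'I_d -> nat)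
    (pi : 'cV[R]_m) : \bar R :=
  (\sum_(i < d)
     ((cnt i)%:R)%:E * lne ((mixture_vec f theta y pi i ord0)%:E))%E.

Definition is_mle (R : realType) (Omega Y : Type) (f : Omega -> Y -> R)
    (m d : nat) (theta : 'I_m -> Omega) (y : 'I_d -> Y) (cnt : 'I_d -> nat)
    (pi : 'cV[R]_m) : Prop :=
  in_simplex pi /\
  forall pi' : 'cV[R]_m, in_simplex pi' ->
    (loglik f theta y cnt pi' <= loglik f theta y cnt pi)%E.

Definition constraint_fun (R : realType) (Omega Y : Type) (f : Omega -> Y -> R)
    (d : nat) (y : 'I_d -> Y) (t : Omega) (w : 'cV[R]_d) : R :=
  \sum_(i < d) w i 0 * f t (y i).

Definition pd_objective (R : realType) (Omega Y : Type) (f : Omega -> Y -> R)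
    (m d : nat) (theta : 'I_m -> Omega) (y : 'I_d -> Y) (cnt : 'I_d -> nat)
    (gamma : R) (w : 'cV[R]_d) : R :=
  \sum_(i < d) (cnt i)%:R / (\sum_(k < d) cnt k)%N%:R * ln (w i 0)
  - gamma^-1 * \sum_(j < m) constraint_fun f y (theta j) w `^ gamma.

Definition is_pd_maximizer (R : realType) (Omega Y : Type)
    (f : Omega -> Y -> R) (m d : nat) (theta : 'I_m -> Omega) (y : 'I_d -> Y)
    (cnt : 'I_d -> nat) (gamma : R) (w : 'cV[R]_d) : Prop :=
  pos_orthant w /\
  forall v : 'cV[R]_d, pos_orthant v ->
    pd_objective f theta y cnt gamma v <= pd_objective f theta y cnt gamma w.

(* The value 0 is a dummy, taken only where no maximizer exists. *)
Definition pd_solution (R : realType) (Omega Y : Type) (f : Omega -> Y -> R)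
    (m d : nat) (theta : 'I_m -> Omega) (y : 'I_d -> Y) (cnt : 'I_d -> nat)
    (gamma : R) : 'cV[R]_d :=
  xget 0 [set w | is_pd_maximizer f theta y cnt gamma w].

Definition candidate (R : realType) (Omega Y : Type) (f : Omega -> Y -> R)
    (m d : nat) (theta : 'I_m -> Omega) (y : 'I_d -> Y) (cnt : 'I_d -> nat)
    (gamma : R) : 'cV[R]_m :=
  let p j :=
    constraint_fun f y (theta j) (pd_solution f theta y cnt gamma) in
  \col_(j < m) (p j `^ (gamma - 1) / (\sum_(k < m) p k `^ (gamma - 1))).

(* Main.v *)
Require Import Defs.
From mathcomp Require Import all_boot all_order all_algebra.
From mathcomp Require Import all_classical all_reals all_analysis.
From mathcomp Require Import ring lra.

Set Implicit Arguments.
Unset Strict Implicit.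
Unset Printing Implicit Defensive.

Import Order.TTheory GRing.Theory Num.Theory.
Import numFieldNormedType.Exports.

Local Open Scope classical_set_scope.
Local Open Scope ring_scope.

(** Write a_ji = f_(theta_j)(y_i), c_i = n_i / n, p_j = p_(theta_j)(w) at the
penalized dual solution w for gamma > 1, and S = sum_j p_j^(gamma-1), so that
the candidate weights are q_j = p_j^(gamma-1) / S.

The stationarity of w reads c_i / w_i = sum_j p_j^(gamma-1) a_ji
([pd_maximizer_foc]). Read differently, it says that
 - the mixture of the candidate is explicit, g_q(y_i) = c_i / (w_i S)
   ([dual_weights_mixture]);
 - multiplied by w_i and summed, sum_j p_j^gamma = 1
   ([pd_maximizer_sum_powR]), whence p_j <= 1.
Young's inequality then turns sum_j p_j^gamma = 1 into S <= 1 + m / gamma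
([pd_maximizer_sum_powRB1_le]), so S is asymptotically at most 1.

Now compare the candidate with an MLE through the ratios
r_i = g_pihat(y_i) / g_q(y_i). The explicit form of g_q gives
sum_i c_i r_i = S sum_j pihat_j p_j <= S ([sum_freq_ratio_le]), while the
optimality of pihat gives sum_i c_i ln r_i >= 0 ([mle_sum_freq_ln_ge0]). As
sum_i c_i = 1, the nonnegative terms c_i (r_i - 1 - ln r_i) add up to at most
S - 1 <= m / gamma, and (sqrt r - 1)^2 <= r - 1 - ln r yields the rate
(sqrt r_i - 1)^2 <= m / (c_i gamma) ([mle_sqr_le]). Hence every r_i tends to 1,
which is the convergence of the mixture vectors.

A maximizer w exists for gamma >= 1 because in the coordinates u = ln w the
objective is continuous on the whole space and is dominated by a constant minus
a weighted l1 norm of u ([pd_objective_expR_le]), so that its maximum over a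
large box is global.

For the last claim, the simplex is compact and a cluster point of the candidates
has the same mixture vector as pihat, hence the same likelihood; it is then an
MLE, and it is pihat when the MLE is unique. *)

(** * Scalar inequalities *)

Section Scalar.
Variable R : realType.
Implicit Types x r c A u : R.

(** This is Young's inequality for x * 1: the graph of x `^ r lies above its
tangent at 1. It is used both for the penalty (with r = gamma) and for the
normalizing sum of the candidate weights (with r = gamma / (gamma - 1)). *)
Lemma mulr_le_powR x r : 0 <= x -> 1 <= r -> r * x <= x `^ r + (r - 1).
Proof.
move=> x0; rewrite le_eqVlt => /predU1P[<-|r1].
  by rewrite powRr1// mul1r subrr addr0.
have r0 : 0 < r by lra.
have q0 : 0 < r / (r - 1) by rewrite divr_gt0// subr_gt0.
have := @conjugate_powR R x 1 r (r / (r - 1)) x0 ler01 r0 q0.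
rewrite powR1 mulr1 mul1r invf_div -{1}div1r -mulrDl addrC subrK.
rewrite divff ?gt_eqF// => /(_ erefl).
by rewrite -mulrDl ler_pdivlMr// mulrC.
Qed.

(** Applying ln s <= s - 1 at s = sqrt x gives
x - 1 - ln x >= s^2 - 1 - 2 (s - 1) = (s - 1)^2. It makes the strict concavity
of ln at 1 quantitative, for x near 0 and near infinity alike. *)
Lemma sqr_sqrtB1_le x : 0 < x -> (Num.sqrt x - 1) ^+ 2 <= x - 1 - ln x.
Proof.
move=> x0; have s0 : 0 < Num.sqrt x by rewrite sqrtr_gt0.
have xs : x = Num.sqrt x ^+ 2 by rewrite sqr_sqrtr// ltW.
have ls : ln (Num.sqrt x) <= Num.sqrt x - 1.
  by rewrite -[X in ln X](subrKC 1) le_ln1Dx//; lra.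
rewrite {2 3}xs lnXn// mulr2n; lra.
Qed.

(** For u >= 0 the claim bounds 2 c u - A exp(u), which the tangent line of exp
of slope 2 c / A at - ln (A / (2 c)) does; for u < 0 dropping A exp(u) is
enough. *)
Lemma linear_sub_expR_le c A : 0 < c -> 0 < A ->
  exists K, forall u, c * u - A * expR u <= K - c * `|u|.
Proof.
move=> c0 A0; exists `|2 * c * (1 + ln (A / (2 * c)))| => u.
have l0 : 0 < A / (2 * c) by rewrite divr_gt0 ?mulr_gt0.
have Ae : 2 * c * (1 + (u + ln (A / (2 * c)))) <= A * expR u.
  have -> : A * expR u = 2 * c * expR (u + ln (A / (2 * c))).
    rewrite expRD lnK// [expR u * _]mulrC mulrA; congr (_ * _).
    by rewrite mulrCA divff ?mulr1// gt_eqF ?mulr_gt0.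
  by rewrite ler_pM2l ?mulr_gt0// expR_ge1Dx.
have [u0|u0] := leP 0 u.
  have := ler_norm (- (2 * c * (1 + ln (A / (2 * c))))).
  rewrite normrN (ger0_norm u0); lra.
have := normr_ge0 (2 * c * (1 + ln (A / (2 * c)))).
have : 0 < A * expR u by rewrite mulr_gt0 ?expR_gt0.
rewrite (ltr0_norm u0); lra.
Qed.

End Scalar.

(** * Topology of matrices *)

Section MatrixTopology.
Variable R : realType.

Lemma cvg_mx (T : Type) (F : set_system T) {FF : Filter F} (m n : nat)
    (M : T -> 'M[R]_(m, n)) (l : 'M[R]_(m, n)) :
  (forall i j, M x i j @[x --> F] --> l i j) -> M x @[x --> F] --> l.
Proof.
move=> Ml A [P lP sPA]; rewrite /nbhs/=.
suff: \forall x \near F, forall i j, P i j (M x i j).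
  by apply: filterS => x Px; apply: sPA.
apply: filter_forall => i; apply: filter_forall => j.
exact: Ml (lP i j).
Qed.

Lemma cvg_sumr (T : Type) (F : set_system T) {FF : Filter F} (k : nat)
    (g : 'I_k -> T -> R) (l : 'I_k -> R) :
  (forall i, g i x @[x --> F] --> l i) ->
  \sum_i g i x @[x --> F] --> \sum_i l i.
Proof. by move=> gl; apply: (cvg_big add_continuous) => i _; exact: gl. Qed.

Lemma compact_rV_box n (a b : R) :
  compact [set v : 'rV[R]_n | forall i, v 0 i \in `[a, b]].
Proof.
exact: (@rV_compact _ n (fun=> `[a, b]%classic) (fun=> @segment_compact _ a b)).
Qed.

Lemma compact_cV_box n (a b : R) :
  compact [set v : 'cV[R]_n | forall i, v i 0 \in `[a, b]].
Proof.
suff -> : [set v : 'cV[R]_n | forall i, v i 0 \in `[a, b]] =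
    @trmx R 1 n @` [set v : 'rV[R]_n | forall i, v 0 i \in `[a, b]].
  apply: continuous_compact (@compact_rV_box n a b).
  apply: continuous_subspaceT => v; apply: (@cvg_mx _ (nbhs v)) => i j.
  by under eq_fun do rewrite mxE; rewrite mxE; exact: coord_continuous.
apply/seteqP; split => [v vab /=|_ [v vab <-] i /=]; last by rewrite mxE.
by exists v^T; rewrite ?trmxK// => i /=; rewrite mxE.
Qed.

End MatrixTopology.

(** * Frequencies and constraint functions *)

Section PenalizedDual.
Variables (R : realType) (Omega Y : Type) (f : Omega -> Y -> R).
Variables (m d : nat) (theta : 'I_m -> Omega) (y : 'I_d -> Y).
Variable cnt : 'I_d -> nat.

Hypothesis f_ge0 : forall t x, 0 <= f t x.
Hypothesis cnt_ge1 : forall i, (1 <= cnt i)%N.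
Hypothesis theta_covers : forall j, exists i, 0 < f (theta j) (y i).
Hypothesis y_covered : forall i, exists j, 0 < f (theta j) (y i).

Local Notation a j i := (f (theta j) (y i)).
Local Notation p j w := (constraint_fun f y (theta j) w).
Local Notation H := (pd_objective f theta y cnt).
Local Notation g pi i := (mixture_vec f theta y pi i 0).
Local Notation is_max := (is_pd_maximizer f theta y cnt).

Definition freq i : R := (cnt i)%:R / (\sum_(k < d) cnt k)%N%:R.

Lemma sum_cnt_gt0 (i : 'I_d) : (0 < \sum_(k < d) cnt k)%N.
Proof. by rewrite (bigD1 i)//= addn_gt0 cnt_ge1. Qed.

Lemma freq_ge i : (\sum_(k < d) cnt k)%N%:R^-1 <= freq i.
Proof.
by rewrite -[leLHS]mul1r ler_wpM2r ?invr_ge0 ?ler0n// ler1n cnt_ge1.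
Qed.

Lemma freq_gt0 i : 0 < freq i.
Proof.
by apply: lt_le_trans (freq_ge i); rewrite invr_gt0 ltr0n (sum_cnt_gt0 i).
Qed.

Lemma sum_freq (i : 'I_d) : \sum_k freq k = 1.
Proof.
by rewrite -mulr_suml -natr_sum divff// pnatr_eq0 -lt0n (sum_cnt_gt0 i).
Qed.

Lemma constraint_gt0 w : pos_orthant w -> forall j, 0 < p j w.
Proof.
move=> w0 j; have [i ai] := theta_covers j.
rewrite /constraint_fun (bigD1 i)//= ltr_pwDl ?mulr_gt0// sumr_ge0// => k _.
by rewrite mulr_ge0// ltW.
Qed.

Lemma constraintD w t i j :
  p j (w + t *: delta_mx i 0) = p j w + t * a j i.
Proof.
rewrite /constraint_fun; under eq_bigr do rewrite mxE mulrDl.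
rewrite big_split/=; congr (_ + _); rewrite (bigD1 i)//= big1 => [|k ki].
  by rewrite !mxE !eqxx mulr1 addr0.
by rewrite !mxE (negbTE ki) mulr0 mul0r.
Qed.

(** * First-order condition of the penalized dual *)

(** Moving only the i-th coordinate of w by t keeps it in the orthant for
|t| < w_i and changes the objective by a function h of one real variable, up to
a constant; h has a maximum at 0, so its derivative there vanishes. *)
Lemma pd_maximizer_foc (gamma : R) w : 0 < gamma -> is_max gamma w ->
  forall i, freq i / w i 0 = \sum_j p j w `^ (gamma - 1) * a j i.
Proof.
move=> g0 [w0 wmax] i.
have wt0 (t : R) : t \in `]- w i 0, w i 0[ ->
    pos_orthant (w + t *: delta_mx i 0).
  rewrite in_itv/= => /andP[tw _] k; rewrite !mxE.
  have [->|_] := eqVneq k i; first by rewrite mulr1; lra.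
  by rewrite mulr0 addr0.
pose h (t : R) := freq i * ln (w i 0 + t)
  - gamma^-1 * \sum_j (p j w + t * a j i) `^ gamma.
have hmax (t : R) : t \in `]- w i 0, w i 0[ -> h t <= h 0.
  move=> tw; have := wmax _ (wt0 t tw); rewrite /pd_objective /h.
  under [X in _ - _ * X <= _ -> _]eq_bigr do rewrite constraintD.
  under [X in _ -> _ <= _ - _ * X]eq_bigr do rewrite mul0r addr0.
  rewrite (bigD1 i)//= [X in _ <= X - _ -> _](bigD1 i)//= addr0.
  rewrite !mxE !eqxx mulr1 -/(freq i).
  under eq_bigr => k ki do rewrite !mxE (negbTE ki) mulr0 addr0.
  lra.
have hderiv (t : R) : t \in `]- w i 0, w i 0[ -> is_derive t 1 h
    (freq i / (w i 0 + t) - \sum_j (p j w + t * a j i) `^ (gamma - 1) * a j i).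
  move=> tw.
  have -> : h = freq i *: (fun s => ln (w i 0 + s))
      - gamma^-1 *: \sum_j (fun s => (p j w + s * a j i) `^ gamma).
    by apply/funext => s; rewrite !fctE fct_sumE.
  have -> : \sum_j (p j w + t * a j i) `^ (gamma - 1) * a j i = gamma^-1 *:
      \sum_j (gamma * (p j w + t * a j i) `^ (gamma - 1)) * a j i.
    rewrite scaler_sumr; apply: eq_bigr => j _.
    by rewrite /GRing.scale/= !mulrA mulVf ?mul1r// gt_eqF.
  apply: is_deriveB.
    apply: is_deriveZ; have wt : 0 < w i 0 + t.
      by move: tw; rewrite in_itv/= => /andP[tw _]; lra.
    have dln := is_derive1_ln wt.
    by apply: is_derive_eq; rewrite add0r mulr1.
  apply: is_deriveZ; apply: is_derive_sum => j.
  have pt : 0 < p j w + t * a j i.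
    by rewrite -constraintD; exact: constraint_gt0 (wt0 t tw) j.
  have dpow := is_derive1_powR gamma pt.
  have dlin : is_derive t 1 (fun s : R => p j w + s * a j i) (a j i).
    by apply: is_derive_eq; rewrite scaler0 !add0r mul1r [LHS]mulr1.
  exact: (@is_derive1_comp _ (@powR R ^~ gamma)
    (fun s : R => p j w + s * a j i)).
have w00 : 0 \in `]- w i 0, w i 0[ by rewrite in_itv/= oppr_lt0 w0.
have d0 := @derive1_at_max _ h _ _ 0 (ge0_cp (ltW (w0 i))).2
  (fun t tw => @ex_derive _ _ _ _ _ _ _ (hderiv t tw)) w00 hmax.
have := @derive_val _ _ _ _ _ _ _ d0.
rewrite (@derive_val _ _ _ _ _ _ _ (hderiv 0 w00)) addr0.
under eq_bigr do rewrite mul0r addr0.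
by move=> /eqP; rewrite subr_eq0 => /eqP.
Qed.

(** * Existence of the penalized dual solution *)

(** By Young's inequality the penalty is at least sum_j p_j - m. This bound is
affine in w, hence separates over the coordinates, and in each coordinate
[linear_sub_expR_le] applies with A = sum_j a_ji > 0. *)
Lemma pd_objective_expR_le (gamma : R) : 1 <= gamma ->
  exists K, forall u : 'rV[R]_d,
    H gamma (\col_i expR (u 0 i)) <= K - \sum_i freq i * `|u 0 i|.
Proof.
move=> g1; have g0 : 0 < gamma by lra.
have A0 i : 0 < \sum_j a j i.
  have [j aj] := y_covered i.
  by rewrite (bigD1 j)//= ltr_pwDl// sumr_ge0.
have /choice[K hK] i := linear_sub_expR_le (freq_gt0 i) (A0 i).
exists (\sum_i K i + m%:R) => u; set w := \col_i _.
have w0 : pos_orthant w by move=> i; rewrite mxE expR_gt0.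
have pen : \sum_j p j w - m%:R <= gamma^-1 * \sum_j p j w `^ gamma.
  rewrite mulr_sumr -[m in m%:R]card_ord -sumr_const -sumrB.
  apply: ler_sum => j _; rewrite ler_pdivlMl//.
  have := mulr_le_powR (ltW (constraint_gt0 w0 j)) g1.
  lra.
have sum_p : \sum_j p j w = \sum_i (\sum_j a j i) * expR (u 0 i).
  rewrite exchange_big; apply: eq_bigr => i _.
  by rewrite mulr_suml; apply: eq_bigr => j _; rewrite mxE mulrC.
rewrite /pd_objective; under eq_bigr do rewrite mxE expRK.
have : \sum_i (freq i * u 0 i - (\sum_j a j i) * expR (u 0 i)) <=
    \sum_i (K i - freq i * `|u 0 i|) by apply: ler_sum => i _.
rewrite !sumrB -sum_p -/freq; lra.
Qed.

(** Stated along an arbitrary filter rather than as a continuity statement, so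
that the convergence lemmas for sums and products apply coordinatewise. *)
Lemma cvg_pd_objective_expR (gamma : R) (T : Type) (F : set_system T)
    {FF : Filter F} (u : T -> 'rV[R]_d) (l : 'rV[R]_d) :
  (forall i, u x 0 i @[x --> F] --> l 0 i) ->
  H gamma (\col_i expR (u x 0 i)) @[x --> F] --> H gamma (\col_i expR (l 0 i)).
Proof.
move=> ul; have l0 : pos_orthant (\col_i expR (l 0 i)).
  by move=> i; rewrite mxE expR_gt0.
apply: cvgB; last apply: cvgMl_tmp.
  apply: cvg_sumr => i; apply: cvgMl_tmp.
  under eq_fun do rewrite mxE expRK; rewrite mxE expRK; exact: ul.
apply: cvg_sumr => j.
apply: (@continuous_cvg _ _ _ _ _ (fun x => p j (\col_i expR (u x 0 i)))
  (@powR R ^~ gamma)).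
  apply: differentiable_continuous; apply/derivable1_diffP; apply: ex_derive.
  by apply: is_derive1_powR; exact: constraint_gt0.
apply: cvg_sumr => i; apply: cvgMr_tmp.
under eq_fun do rewrite mxE; rewrite mxE.
apply: (@continuous_cvg _ _ _ _ _ (fun x => u x 0 i) (@expR R)) => //.
exact: continuous_expR.
Qed.

Lemma continuous_pd_objective_expR (gamma : R) :
  continuous (fun u : 'rV[R]_d => H gamma (\col_i expR (u 0 i))).
Proof.
move=> u; apply: (@cvg_pd_objective_expR _ _ (nbhs u) _ id) => i.
exact: coord_continuous.
Qed.

Lemma pd_maximizer_exists (gamma : R) : 1 <= gamma -> exists w, is_max gamma w.
Proof.
move=> g1; have [K hK] := pd_objective_expR_le g1.
pose G (u : 'rV[R]_d) := H gamma (\col_i expR (u 0 i)).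
pose n : R := (\sum_(k < d) cnt k)%N%:R.
(* Since c_i >= 1 / n, a coordinate larger than B in absolute value makes the
   bound of pd_objective_expR_le fall below the value at the origin. *)
pose B := n * `|K - G 0|.
have B0 : 0 <= B by rewrite mulr_ge0 ?ler0n.
have box0 : [set v : 'rV[R]_d | forall i, v 0 i \in `[- B, B]] !=set0.
  by exists 0 => i /=; rewrite mxE in_itv/= oppr_le0 B0.
have [u uB umax] := EVT_max_rV box0 (@compact_rV_box _ _ (- B) B)
  (continuous_subspaceT (@continuous_pd_objective_expR gamma)).
have Gmax v : G v <= G u.
  have [vB|] := pselect (forall i, v 0 i \in `[- B, B]).
    by apply: umax; rewrite inE.
  move=> /existsNP[i]; rewrite in_itv/= -ler_norml => /negP; rewrite -ltNge.
  move=> vi; apply: (@le_trans _ _ (G 0)); last first.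
    by apply: umax; rewrite inE => k; rewrite mxE in_itv/= oppr_le0 B0.
  apply: le_trans (hK v) _; rewrite lerBlDr -lerBlDl.
  apply: le_trans (ler_norm _) _.
  apply: (@le_trans _ _ (freq i * `|v 0 i|)).
    have n0 : 0 < n by rewrite ltr0n (sum_cnt_gt0 i).
    rewrite -[leLHS](mulKf (lt0r_neq0 n0)) -/B.
    by rewrite ler_pM //; [rewrite invr_ge0 ltW|exact: freq_ge|exact: ltW].
  rewrite (bigD1 i)//= lerDl sumr_ge0// => k _.
  by rewrite mulr_ge0// ltW// freq_gt0.
exists (\col_i expR (u 0 i)); split => [i|v v0]; first by rewrite mxE expR_gt0.
have := Gmax (\row_i ln (v i 0)); rewrite /G.
suff -> : \col_i expR ((\row_i ln (v i 0)) 0 i) = v by [].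
by apply/colP => i; rewrite !mxE lnK// posrE.
Qed.

(** * The candidate weights at a penalized dual solution *)

Definition dual_weights (gamma : R) (w : 'cV[R]_d) : 'cV[R]_m :=
  \col_j (p j w `^ (gamma - 1) / \sum_k p k w `^ (gamma - 1)).

Section Maximizer.
Variables (gamma : R) (w : 'cV[R]_d).
Hypothesis gamma_gt1 : 1 < gamma.
Hypothesis w_max : is_max gamma w.

Local Notation S := (\sum_j p j w `^ (gamma - 1)).

Let gamma_gt0 : 0 < gamma.
Proof. exact: lt_trans ltr01 gamma_gt1. Qed.

(** Euler's identity for the penalty: sum_j p_j p_j^(gamma-1) is expanded
through p_j = sum_i w_i a_ji and regrouped by i, where the first-order condition
leaves c_i. *)
Lemma pd_maximizer_sum_powR (i : 'I_d) : \sum_j p j w `^ gamma = 1.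
Proof.
have [w0 _] := w_max; have g0 := gamma_gt0.
rewrite -(sum_freq i).
transitivity (\sum_j \sum_k w k 0 * (p j w `^ (gamma - 1) * a j k)).
  apply: eq_bigr => j _; rewrite -mulr_powRB1//; last first.
    exact/ltW/constraint_gt0.
  by rewrite {1}/constraint_fun mulr_suml; apply: eq_bigr => k _; ring.
rewrite exchange_big; apply: eq_bigr => k _ /=.
rewrite -mulr_sumr -(pd_maximizer_foc g0 w_max k).
by rewrite mulrC divfK// lt0r_neq0.
Qed.

Lemma pd_maximizer_constraint_le1 j : p j w <= 1.
Proof.
have [w0 _] := w_max; have [i _] := theta_covers j.
rewrite leNgt; apply/negP => pj1.
have : p j w <= p j w `^ gamma by rewrite le1r_powR// ltW.
have : p j w `^ gamma <= 1.
  rewrite -[leRHS](pd_maximizer_sum_powR i) (bigD1 j)//= lerDl.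
  by rewrite sumr_ge0// => k _; exact: powR_ge0.
lra.
Qed.

(** With r = gamma / (gamma - 1), Young's inequality at x = p_j^(gamma-1) gives
x <= (1 - 1 / gamma) p_j^gamma + 1 / gamma, to be summed over j. *)
Lemma pd_maximizer_sum_powRB1_le (i : 'I_d) : S <= 1 + m%:R / gamma.
Proof.
have [w0 _] := w_max; have g0 := gamma_gt0.
have d0 : 0 < gamma - 1 by rewrite subr_gt0.
rewrite -[X in _ <= X + _](pd_maximizer_sum_powR i).
rewrite -[m in m%:R]card_ord -sumr_const mulr_suml -big_split/=.
apply: ler_sum => j _; rewrite mul1r.
have r1 : 1 <= gamma / (gamma - 1) by rewrite ler_pdivlMr//; lra.
have := mulr_le_powR (powR_ge0 (p j w) (gamma - 1)) r1.
rewrite -powRrM mulrCA divff ?mulr1 ?gt_eqF//.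
have -> : gamma / (gamma - 1) - 1 = (gamma - 1)^-1 by field; rewrite gt_eqF.
rewrite mulrAC ler_pdivrMr// mulrDl mulVf ?gt_eqF// => h.
rewrite -(ler_pM2l g0) mulrDr divff ?gt_eqF//.
apply: (le_trans h); rewrite lerD2r mulrC ler_wpM2r ?powR_ge0//; lra.
Qed.

Lemma sum_powRB1_gt0 (j : 'I_m) : 0 < S.
Proof.
have [w0 _] := w_max; rewrite (bigD1 j)//= ltr_pwDl//.
  by rewrite powR_gt0//; exact: constraint_gt0.
by rewrite sumr_ge0// => k _; exact: powR_ge0.
Qed.

Local Notation q := (dual_weights gamma w).

Lemma dual_weights_simplex (j : 'I_m) : in_simplex q.
Proof.
have S0 := sum_powRB1_gt0 j; split=> [k|].
  by rewrite mxE divr_ge0 ?powR_ge0// ltW.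
by under eq_bigr do rewrite mxE; rewrite -mulr_suml divff// gt_eqF.
Qed.

Lemma dual_weights_mixture i :
  g q i = freq i / (w i 0 * S).
Proof.
have g0 := gamma_gt0.
rewrite mxE invfM mulrA (pd_maximizer_foc g0 w_max i).
by rewrite mulr_suml; apply: eq_bigr => j _; rewrite mxE mulrAC.
Qed.

Lemma dual_weights_mixture_gt0 i : 0 < g q i.
Proof.
have [w0 _] := w_max; have [j _] := y_covered i.
by rewrite dual_weights_mixture divr_gt0 ?freq_gt0// mulr_gt0// sum_powRB1_gt0.
Qed.

(** Minus 1, the left-hand side is the derivative of l / n at q in the direction
pi - q. The explicit g_q makes each c_i / g_q(y_i)
equal to S w_i, so the sum is S times an average of the p_j <= 1. *)
Lemma sum_freq_ratio_le (pi : 'cV[R]_m) : in_simplex pi ->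
  \sum_i freq i * (g pi i / g q i) <= S.
Proof.
move=> [pi0 pi1]; have [w0 _] := w_max.
have S0 : 0 <= S by rewrite sumr_ge0// => j _; exact: powR_ge0.
have -> : \sum_i freq i * (g pi i / g q i) = S * \sum_j pi j 0 * p j w.
  transitivity (\sum_i \sum_j S * (pi j 0 * (w i 0 * a j i))).
    apply: eq_bigr => i _; have [j _] := y_covered i.
    rewrite dual_weights_mixture mxE -mulr_sumr.
    have -> : \sum_j pi j 0 * (w i 0 * a j i) = w i 0 * \sum_j pi j 0 * a j i.
      by rewrite mulr_sumr; apply: eq_bigr => k _; rewrite mulrCA.
    by field; rewrite !gt_eqF ?sum_powRB1_gt0 ?freq_gt0.
  rewrite exchange_big mulr_sumr; apply: eq_bigr => j _.
  by rewrite /constraint_fun !mulr_sumr.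
rewrite -[leRHS]mulr1 ler_wpM2l// -pi1; apply: ler_sum => j _.
by rewrite -[leRHS]mulr1 ler_wpM2l//; exact: pd_maximizer_constraint_le1.
Qed.

End Maximizer.

(** * Comparison with a maximum likelihood estimator *)

Lemma loglik_EFin pi : (forall i, 0 < g pi i) ->
  loglik f theta y cnt pi = (\sum_i (cnt i)%:R * ln (g pi i))%:E.
Proof.
move=> g0; rewrite /loglik -sumEFin; apply: eq_bigr => i _.
by rewrite lne_EFin// EFinM.
Qed.

Lemma loglik_gtNy pi : (-oo < loglik f theta y cnt pi)%E ->
  forall i, 0 < g pi i.
Proof.
move=> lpi i; rewrite ltNge; apply/negP => gi.
have : loglik f theta y cnt pi = -oo%E; last by move=> lE; rewrite lE in lpi.
apply/eqP; rewrite esum_eqNy; apply/existsP; exists i => /=.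
by rewrite gi gt0_muleNy// lte_fin ltr0n.
Qed.

(** The log-likelihood of an MLE is at least the finite one of q, which rules
out a vanishing coordinate of the mixture. *)
Lemma mle_mixture_gt0 pihat q : is_mle f theta y cnt pihat ->
  in_simplex q -> (forall i, 0 < g q i) -> forall i, 0 < g pihat i.
Proof.
move=> [_ mle] qs q0; apply: loglik_gtNy.
by apply: lt_le_trans (mle q qs); rewrite loglik_EFin// ltNyr.
Qed.

Lemma mle_sum_freq_ln_ge0 pihat q : is_mle f theta y cnt pihat ->
  in_simplex q -> (forall i, 0 < g q i) ->
  0 <= \sum_i freq i * ln (g pihat i / g q i).
Proof.
move=> mle qs q0; have p0 := mle_mixture_gt0 mle qs q0.
have := mle.2 q qs; rewrite !loglik_EFin// lee_fin -subr_ge0 -sumrB => le.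
under eq_bigr do rewrite ln_div ?posrE// /freq mulrAC mulrBr.
by rewrite -mulr_suml mulr_ge0// invr_ge0 ler0n.
Qed.

(** Each term c_k (r_k - 1 - ln r_k) is nonnegative, so the i-th one is bounded
by their sum, in turn at most S - 1 <= m / gamma. *)
Lemma mle_sqr_le pihat (gamma : R) w i : 1 < gamma -> is_max gamma w ->
  is_mle f theta y cnt pihat ->
  (Num.sqrt (g pihat i / g (dual_weights gamma w) i) - 1) ^+ 2
    <= m%:R / freq i / gamma.
Proof.
move=> g1 wmax mle; set q := dual_weights gamma w; have [j _] := y_covered i.
have c0 k : 0 < freq k by exact: freq_gt0.
have qs : in_simplex q by exact: (dual_weights_simplex wmax j).
have q0 : forall k, 0 < g q k.
  exact: dual_weights_mixture_gt0.
have p0 := mle_mixture_gt0 mle qs q0.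
have r0 k : 0 < g pihat k / g q k by rewrite divr_gt0.
have sum_r := sum_freq_ratio_le g1 wmax mle.1.
have sum_S := pd_maximizer_sum_powRB1_le g1 wmax i.
have sum_ln := mle_sum_freq_ln_ge0 mle qs q0.
rewrite mulrAC ler_pdivlMr// mulrC.
apply: (@le_trans _ _ (freq i *
    (g pihat i / g q i - 1 - ln (g pihat i / g q i)))).
  by rewrite ler_pM2l// sqr_sqrtB1_le.
apply: (@le_trans _ _ (\sum_k freq k *
    (g pihat k / g q k - 1 - ln (g pihat k / g q k)))).
  rewrite [leRHS](bigD1 i)//= lerDl sumr_ge0// => k _.
  rewrite mulr_ge0//; first exact: ltW.
  exact: le_trans (sqr_ge0 _) (sqr_sqrtB1_le (r0 k)).
under eq_bigr do rewrite 2!mulrBr mulr1.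
rewrite 2!sumrB (sum_freq i); lra.
Qed.

(** * Convergence *)

Lemma pd_solutionP (gamma : R) : 1 <= gamma ->
  is_max gamma (pd_solution f theta y cnt gamma).
Proof.
move=> g1; have [w wmax] := pd_maximizer_exists g1.
exact: (xgetPex 0 (ex_intro _ w wmax)).
Qed.

Lemma cvg_mixture_candidate pihat : is_mle f theta y cnt pihat ->
  mixture_vec f theta y (candidate f theta y cnt gamma) @[gamma --> +oo] -->
  mixture_vec f theta y pihat.
Proof.
move=> mle; apply: cvg_mx => i k; rewrite (ord1 k) {k}.
pose q := candidate f theta y cnt; have [j _] := y_covered i.
have q_facts : \forall gamma \near +oo, 0 < g (q gamma) i /\
    (Num.sqrt (g pihat i / g (q gamma) i) - 1) ^+ 2 <=
    m%:R / freq i / gamma.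
  near=> gamma.
  have g1 : 1 < gamma by near: gamma; exact: nbhs_pinfty_gt.
  have wmax := pd_solutionP (ltW g1); split.
    exact: (dual_weights_mixture_gt0 g1 wmax).
  exact: (mle_sqr_le i g1 wmax mle).
have pi0 : 0 < g pihat i.
  (* Any weights with positive mixture will do; gamma = 2 supplies some. *)
  have wmax := pd_solutionP (ler1n R 2).
  have g1 : 1 < 2 :> R by rewrite ltr1n.
  apply: (mle_mixture_gt0 mle (dual_weights_simplex wmax j)).
  exact: (dual_weights_mixture_gt0 g1 wmax).
have bound0 : m%:R / freq i / gamma @[gamma --> +oo] --> (0 : R).
  have inv0 : gamma^-1 @[gamma --> +oo] --> (0 : R).
    apply: (gtr0_cvgV0 _).2 => //; exact: nbhs_pinfty_gt.
  have := cvgMl_tmp (a := m%:R / freq i) inv0; rewrite mulr0; exact.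
pose s gamma := Num.sqrt (g pihat i / g (q gamma) i).
have sqr0 : (s gamma - 1) ^+ 2 @[gamma --> +oo] --> (0 : R).
  apply: (squeeze_cvgr _ (cvg_cst 0) bound0).
  by apply: filterS q_facts => gamma [_ ->]; rewrite sqr_ge0.
have sqrt1 : s gamma @[gamma --> +oo] --> (1 : R).
  apply/cvgrPdist_lt => e e0; have e20 : 0 < e ^+ 2 by rewrite exprn_gt0.
  move/cvgr0_norm_lt : sqr0 => /(_ _ e20); apply: filterS => gamma.
  by rewrite normrX ltr_sqr ?nnegrE ?(ltW e0)// distrC.
have ratio1 : (s gamma * s gamma)^-1 * g pihat i @[gamma --> +oo] -->
    g pihat i.
  have inv1 : (s gamma * s gamma)^-1 @[gamma --> +oo] --> (1 * 1 : R)^-1.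
    by apply: cvgV; [rewrite mulr1 oner_neq0|exact: cvgM].
  have := cvgMr_tmp (b := g pihat i) inv1.
  rewrite mulr1 invr1 mul1r; exact.
apply: cvg_trans ratio1; apply: near_eq_cvg.
apply: filterS q_facts => gamma [q0 _].
rewrite /s -expr2 sqr_sqrtr ?divr_ge0 ?ltW//; field.
by rewrite !gt_eqF.
Unshelve. all: by end_near. Qed.

(** A filter that eventually stays in a compact set and clusters only at one
point converges to it. A cluster point z is the limit of a finer filter G: it
lies in the closed simplex, and its mixture vector is, by continuity and by
[cvg_mixture_candidate], that of pihat, so z is an MLE. *)
Lemma cvg_candidate pihat : is_mle f theta y cnt pihat ->
  (forall pi', is_mle f theta y cnt pi' -> pi' = pihat) ->
  candidate f theta y cnt gamma @[gamma --> +oo] --> pihat.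
Proof.
move=> mle mle_uniq; have [[pihat0 pihat1] _] := mle.
(* A compact neighborhood of pihat is required, hence a box that contains the
   simplex in its interior. *)
pose V := [set v : 'cV[R]_m | forall i, v i 0 \in `[- 1, 2]].
have V_cpt : compact V by exact: compact_cV_box.
have le1 (v : 'cV[R]_m) : in_simplex v -> forall j, v j 0 <= 1.
  move=> [v0 <-] j; rewrite (bigD1 j)//= lerDl sumr_ge0//.
have F_simplex : \forall gamma \near +oo,
    in_simplex (candidate f theta y cnt gamma).
  near=> gamma.
  have g1 : 1 <= gamma by near: gamma; exact: nbhs_pinfty_ge.
  have [j _] : exists j : 'I_m, True.
    case: (pickP 'I_m) => [j _|no]; first by exists j.
    by move: pihat1; rewrite big_pred0// => /esym/eqP; rewrite oner_eq0.
  exact: (dual_weights_simplex (pd_solutionP g1) j).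
have FV : \forall gamma \near +oo, V (candidate f theta y cnt gamma).
  apply: filterS F_simplex => gamma qs j; rewrite in_itv/=.
  by have := qs.1 j; have := le1 _ qs j; lra.
have nV : nbhs pihat V.
  exists (fun _ _ => `[- 1, 2]%classic) => /= [i k|v vV i]; last exact: vV.
  have : pihat i k \in `]- 1, 2[.
    rewrite (ord1 k) in_itv/=.
    by have := pihat0 i; have := le1 _ mle.1 i; lra.
  by move=> /near_in_itvoo; apply: filterS; exact: subset_itv_oo_cc.
have cluster_sub z : cluster (candidate f theta y cnt @ +oo) z -> z = pihat.
  rewrite cluster_cvgE => -[G PG [Gz FG]]; apply: mle_uniq.
  have Gcoord j : (v : 'cV[R]_m) j 0 @[v --> G] --> z j 0.
    apply: (@continuous_cvg _ _ _ _ _ id (fun v : 'cV[R]_m => v j 0)) => //.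
    exact: coord_continuous.
  have zs : in_simplex z.
    have Gs : G [set v | in_simplex v] by exact: FG F_simplex.
    split=> [j|].
      apply: (closed_cvg _ (@closed_ge R 0) _ _ (Gcoord j)).
      by apply: filterS Gs => v [v0 _]; exact: v0.
    have Gsum : \sum_j (v : 'cV[R]_m) j 0 @[v --> G] --> \sum_j z j 0.
      exact: (@cvg_sumr R _ G _ m (fun j (v : 'cV[R]_m) => v j 0)).
    apply: (closed_cvg _ (@closed_eq R 1) _ _ Gsum).
    by apply: filterS Gs => v [].
  have zg : mixture_vec f theta y z = mixture_vec f theta y pihat.
    apply: (@cvg_unique _ (@norm_hausdorff _ _) (mixture_vec f theta y @ G)).
      apply: cvg_mx => i k; rewrite (ord1 k) mxE; under eq_fun do rewrite mxE.
      by apply: cvg_sumr => j; apply: cvgMr_tmp.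
    by move=> A /(cvg_mixture_candidate mle); exact: FG.
  by split=> // pi' pi's; rewrite /loglik zg; exact: mle.2.
apply: (@compact_cluster_set1 _ pihat _ V) => //.
apply/seteqP; split=> [z /cluster_sub->//|_ ->].
have [z [_ zc]] := V_cpt (candidate f theta y cnt @ +oo) _ FV.
by rewrite -(cluster_sub z zc).
Unshelve. all: by end_near. Qed.

End PenalizedDual.

Theorem theorem3 (R : realType) (disp : measure_display)
    (Y : measurableType disp) (mu : {measure set Y -> \bar R})
    (Omega : Type) (f : Omega -> Y -> R)
    (m d : nat) (theta : 'I_m -> Omega) (y : 'I_d -> Y) (cnt : 'I_d -> nat)
    (f_density : density_family mu f)
    (theta_inj : injective theta)
    (y_inj : injective y)
    (cnt_ge1 : forall i : 'I_d, (1 <= cnt i)%N)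
    (theta_covers : forall j : 'I_m, exists i : 'I_d, 0 < f (theta j) (y i))
    (y_covered : forall i : 'I_d, exists j : 'I_m, 0 < f (theta j) (y i))
    (pihat : 'cV[R]_m)
    (pihat_mle : is_mle f theta y cnt pihat) :
  ((mixture_vec f theta y (candidate f theta y cnt gamma)
      @[gamma --> +oo]) --> mixture_vec f theta y pihat) /\
  ((forall pi' : 'cV[R]_m, is_mle f theta y cnt pi' -> pi' = pihat) ->
   (candidate f theta y cnt gamma @[gamma --> +oo]) --> pihat).
Proof.
have f_ge0 t x : 0 <= f t x by have [_ ->] := f_density t.
split; first exact: cvg_mixture_candidate.
exact: cvg_candidate.
Qed.
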